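(* Let $G$ be a finitely generated group and let $\mu$ be a Borel probability measure on $\mathcal{O}_{Rel}(G)$ which is invariant under the conjugation action of $G$. Then there is a set $Z\subset\mathcal{O}_{Rel}(G)$ with $\mu(Z)=0$ such that for every relative order $\preceq$ of $G$ (with respect to a subgroup $C$, which depends on $\preceq$) with $\phi_{(\preceq,C)}\in\mathcal{O}_{Rel}(G)\setminus Z$, the left multiplication action of $G$ on the totally ordered set $(G/C,\preceq)$ has no crossings.
   Context: A proper subgroup $C$ of a group $G$ is relatively convex if there is a total order $\preceq$ on the set of left cosets $G/C$ which is invariant under left multiplication by $G$: if $fC\preceq gC$ then $hfC\preceq hgC$ for all $f,g,h\in G$. Such an order $\preceq$ is called a relative order of $G$ with respect to $C$. $\mathcal{O}_{Rel}(G)$ denotes the set of all relative orders of $G$, with respect to all relatively convex subgroups $C$. A relative order $\preceq$ with respect to $C$ is identified with the function $\phi_{(\preceq,C)}\in\{1,-1,*\}^G$ given by $\phi_{(\preceq,C)}(g)=1$ if $C\prec gC$, $-1$ if $gC\prec C$, and $*$ if $gC=C$. $\mathcal{O}_{Rel}(G)$ has the topology induced from the product topology on $\{1,-1,*\}^G$ (with $\{1,-1,*\}$ discrete). $G$ acts on $\mathcal{O}_{Rel}(G)$ by conjugation, by the homeomorphisms $\phi\mapsto\phi^g$, $\phi^g(h)=\phi(ghg^{-1})$. Let $G$ act by order-preserving bijections of a totally ordered set $(\Omega,\leq)$. A crossing for the action is a 5-tuple $(f,g;u,v,w)$ with $f,g\in G$ and $u,v,w\in\Omega$ such that: (i) $u<w<v$;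 (ii) $g^n(u)<v$ and $u<f^n(v)$ for every $n\in\mathbb{N}$; (iii) there exist $M,N\in\mathbb{N}$ such that $f^N(v)<w<g^M(u)$. *)

(* Defs.v *)
From HB Require Import structures.
From mathcomp Require Import all_boot all_order all_algebra.
From mathcomp Require Import all_classical all_reals all_analysis.

Set Implicit Arguments.
Unset Strict Implicit.
Unset Printing Implicit Defensive.

Import Order.TTheory.

Local Open Scope classical_set_scope.
Local Open Scope group_scope.

Definition is_subgroup (G : groupType) (C : set G) : Prop :=
  group_closed (mem C).

Definition finitely_generated (G : groupType) : Prop :=
  exists s : seq G, smallest (@is_subgroup G) [set` s] = setT.

Section Cosets.
Variables (G : groupType) (C : set G).

Definition left_coset (g : G) : set G := [set g * c | c in C].

(* G/C; used as a type through the coercion from sets to types. *)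
Definition left_cosets : set (set G) := range left_coset.

Lemma left_coset_in g : left_coset g \in left_cosets.
Proof. by apply/mem_set; exists g. Qed.

Definition coset_class (g : G) : left_cosets := @exist _ _ (left_coset g) (left_coset_in g).

Lemma coset_classP (X : left_cosets) : exists g, X = coset_class g.
Proof.
case: X => X XC; have [g _ gX] := set_mem XC.
by exists g; apply/val_inj; rewrite /= gX.
Qed.

Lemma lmul_left_coset (h g : G) :
  [set h * x | x in left_coset g] = left_coset (h * g).
Proof.
apply/seteqP; split => [_ [_ [c Cc <-] <-]|_ [c Cc <-]].
  by exists c => //; rewrite mulgA.
by exists (g * c); [exists c | rewrite mulgA].
Qed.

Lemma lmul_coset_in (h : G) (X : left_cosets) :
  [set h * x | x in val X] \in left_cosets.
Proof.
by have [g ->] := coset_classP X; rewrite /= lmul_left_coset left_coset_in.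
Qed.

Definition lmul_coset (h : G) (X : left_cosets) : left_cosets :=
  @exist _ _ [set h * x | x in val X] (lmul_coset_in h X).

Lemma lmul_coset_class h g : lmul_coset h (coset_class g) = coset_class (h * g).
Proof. exact/val_inj/lmul_left_coset. Qed.

End Cosets.

Record rel_order (G : groupType) := RelOrder {
  ro_sub : set G;
  ro_le : rel (left_cosets ro_sub);
  ro_subgroup : is_subgroup ro_sub;
  ro_proper : ro_sub != setT;
  ro_anti : antisymmetric ro_le;
  ro_trans : transitive ro_le;
  ro_total : total ro_le;
  ro_inv : forall f g h : G,
    ro_le (coset_class ro_sub f) (coset_class ro_sub g) ->
    ro_le (coset_class ro_sub (h * f)) (coset_class ro_sub (h * g)) }.

Fact coset_display : Order.disp_t. Proof. exact: (Order.Disp tt tt). Qed.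

Section CosetOrder.
Variables (G : groupType) (r : rel_order G).

(* The totally ordered set (G/C, <=) underlying a relative order. *)
Definition coset_space : Type := left_cosets (ro_sub r).

HB.instance Definition _ := Choice.on coset_space.

Let ro_refl : reflexive (@ro_le G r).
Proof. by move=> X; have := ro_total X X; rewrite orbb. Qed.

HB.instance Definition _ := Order.Le_isPOrder.Build coset_display coset_space
  ro_refl (@ro_anti G r) (@ro_trans G r).
HB.instance Definition _ := Order.POrder_isTotal.Build coset_display coset_space
  (@ro_total G r).

Definition coset_at (g : G) : coset_space := coset_class (ro_sub r) g.

End CosetOrder.

Record order_action (G : groupType) d (Omega : orderType d) := OrderAction {
  oact :> G -> Omega -> Omega;
  oact1 : forall x, oact 1 x = x;
  oactM : forall f g x, oact (f * g) x = oact f (oact g x);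
  oact_homo : forall f, {homo oact f : x y / (x <= y)%O} }.

Definition crossing (G : groupType) d (Omega : orderType d)
    (a : order_action G Omega) (f g : G) (u v w : Omega) : Prop :=
  [/\ (u < w < v)%O,
      forall n : nat, (a (g ^+ n) u < v)%O /\ (u < a (f ^+ n) v)%O &
      exists M N : nat, (a (f ^+ N) v < w < a (g ^+ M) u)%O].

Definition no_crossings (G : groupType) d (Omega : orderType d)
    (a : order_action G Omega) : Prop :=
  forall (f g : G) (u v w : Omega), ~ crossing a f g u v w.

Section LeftMultiplication.
Variables (G : groupType) (r : rel_order G).

Definition lmul_at (h : G) (X : coset_space r) : coset_space r :=
  lmul_coset h X.

Let lmul1 X : lmul_at 1 X = X.
Proof.
have [g ->] := coset_classP X.
by rewrite /lmul_at lmul_coset_class mul1g.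
Qed.

Let lmulM f g X : lmul_at (f * g) X = lmul_at f (lmul_at g X).
Proof.
have [h ->] := coset_classP X.
by rewrite /lmul_at !lmul_coset_class mulgA.
Qed.

Let lmul_homo f : {homo lmul_at f : X Y / (X <= Y)%O}.
Proof.
move=> X Y; have [g ->] := coset_classP X; have [h ->] := coset_classP Y.
by rewrite /lmul_at !lmul_coset_class; exact: ro_inv.
Qed.

Definition lmul_action : order_action G (coset_space r) :=
  OrderAction lmul1 lmulM lmul_homo.

End LeftMultiplication.

(* The three-point discrete space {1, -1, *}. *)
Inductive sgn3 := Pos | Neg | Star.

Definition option_of_sgn3 (s : sgn3) : option bool :=
  match s with Pos => Some true | Neg => Some false | Star => None end.
Definition sgn3_of_option (o : option bool) : sgn3 :=
  match o with Some true => Pos | Some false => Neg | None => Star end.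
Lemma option_of_sgn3K : cancel option_of_sgn3 sgn3_of_option.
Proof. by case. Qed.

HB.instance Definition _ := Finite.copy sgn3 (can_type option_of_sgn3K).
HB.instance Definition _ := hasNbhs.Build sgn3 principal_filter.
HB.instance Definition _ := Discrete_ofNbhs.Build sgn3 erefl.

Definition phi (G : groupType) (r : rel_order G) : {ptws G -> sgn3} :=
  fun g => if (coset_at r 1 < coset_at r g)%O then Pos
           else if (coset_at r g < coset_at r 1)%O then Neg
           else Star.

(* Relative orders as points of the product space; the type [ORel G] carries
   the subspace topology. *)
Definition ORel (G : groupType) : set {ptws G -> sgn3} := range (@phi G).
Arguments ORel : clear implicits.

Lemma phi_in (G : groupType) (r : rel_order G) : phi r \in ORel G.
Proof. by apply/mem_set; exists r. Qed.

Definition ORel_of (G : groupType) (r : rel_order G) : ORel G :=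
  @exist _ _ (phi r) (phi_in r).

Section Conjugation.
Variable G : groupType.

Definition conj_fun (g : G) (p : {ptws G -> sgn3}) : {ptws G -> sgn3} :=
  fun h => p (g * h * g^-1).

(* The relative order realising [conj_fun g (phi r)]: its subgroup is
   g^-1 C g and it compares X and Y as [r] compares X g^-1 and Y g^-1. *)
Section ConjOrder.
Variables (r : rel_order G) (g : G).
Let C := ro_sub r.
Definition conj_sub : set G := [set h | C (g * h * g^-1)].

Lemma rmul_left_coset h :
  [set x * g^-1 | x in left_coset conj_sub h] = left_coset C (h * g^-1).
Proof.
apply/seteqP; split => [_ [_ [c Cc <-] <-]|_ [c Cc <-]].
  by exists (g * c * g^-1) => //; rewrite !mulgA mulgVK.
exists (h * (g^-1 * c * g)); last by rewrite !mulgA mulgK.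
by exists (g^-1 * c * g) => //=; rewrite /conj_sub /= !mulgA mulgV mul1g mulgK.
Qed.

Lemma rmul_coset_in (X : left_cosets conj_sub) :
  [set x * g^-1 | x in val X] \in left_cosets C.
Proof.
by have [h ->] := coset_classP X; rewrite /= rmul_left_coset left_coset_in.
Qed.

Definition rmul_coset (X : left_cosets conj_sub) : left_cosets C :=
  @exist _ _ [set x * g^-1 | x in val X] (rmul_coset_in X).

Lemma rmul_coset_class h :
  rmul_coset (coset_class conj_sub h) = coset_class C (h * g^-1).
Proof. exact/val_inj/rmul_left_coset. Qed.

Lemma rmul_coset_inj : injective rmul_coset.
Proof.
move=> X Y /(congr1 val) /= XY; apply/val_inj => /=.
have E (Z : set G) : Z = [set x * g | x in [set x * g^-1 | x in Z]].
  apply/seteqP; split => [x Zx|_ [_ [x Zx <-] <-]]; last by rewrite mulgVK.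
  by exists (x * g^-1); [exists x|rewrite mulgVK].
by rewrite (E (val X)) XY -E.
Qed.

Lemma conj_subgroup : is_subgroup conj_sub.
Proof.
have [C1 CV] := ro_subgroup r; split.
  by apply/mem_set; rewrite /conj_sub /= mulg1 mulgV; exact/set_mem.
move=> x y /set_mem Cx /set_mem Cy; apply/mem_set; rewrite /conj_sub /=.
have := CV _ _ (mem_set Cx) (mem_set Cy) => /set_mem.
by rewrite !invgM invgK !mulgA mulgVK.
Qed.

Lemma conj_proper : conj_sub != setT.
Proof.
apply: contra_neq (ro_proper r) => CT; apply/seteqP; split => // x _.
have : conj_sub (g^-1 * x * g) by rewrite CT.
by rewrite /conj_sub /= !mulgA mulgV mul1g mulgK.
Qed.

Definition conj_le : rel (left_cosets conj_sub) :=
  fun X Y => ro_le (rmul_coset X) (rmul_coset Y).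

Lemma conj_anti : antisymmetric conj_le.
Proof. by move=> X Y XY; exact/rmul_coset_inj/ro_anti. Qed.

Lemma conj_trans : transitive conj_le.
Proof. by move=> Y X Z; exact: ro_trans. Qed.

Lemma conj_total : total conj_le.
Proof. by move=> X Y; exact: ro_total. Qed.

Lemma conj_inv x y h :
  conj_le (coset_class conj_sub x) (coset_class conj_sub y) ->
  conj_le (coset_class conj_sub (h * x)) (coset_class conj_sub (h * y)).
Proof.
by rewrite /conj_le !rmul_coset_class -!mulgA; exact: ro_inv.
Qed.

Definition conj_order : rel_order G :=
  RelOrder conj_subgroup conj_proper conj_anti conj_trans conj_total conj_inv.

Lemma phi_conj_order : phi conj_order = conj_fun g (phi r).
Proof.
have le_inv f h k : ro_le (coset_class C (k * f)) (coset_class C (k * h)) =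
    ro_le (coset_class C f) (coset_class C h).
  apply/idP/idP; last exact: ro_inv.
  by move=> /(ro_inv k^-1); rewrite !mulKg.
have leE x y : (coset_at conj_order x <= coset_at conj_order y)%O =
    (coset_at r (g * x * g^-1) <= coset_at r (g * y * g^-1))%O.
  rewrite /Order.le /= /conj_le !rmul_coset_class -(le_inv _ _ g).
  by rewrite !mulgA.
apply/funext => h; rewrite /phi /conj_fun !ltNge !leE.
by rewrite mulg1 mulgV.
Qed.

End ConjOrder.

Lemma conj_ORel_in (g : G) (p : ORel G) : conj_fun g (val p) \in ORel G.
Proof.
case: p => p /= /set_mem[r _ <-].
by apply/mem_set; exists (conj_order r g) => //; exact: phi_conj_order.
Qed.

Definition conj_ORel (g : G) (p : ORel G) : ORel G :=
  @exist _ _ (conj_fun g (val p)) (conj_ORel_in g p).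

End Conjugation.

(* Measurable types have a distinguished point, but [ORel G] may be empty, so
   the point is a parameter.  It does not affect the sigma-algebra. *)
Definition pORel (G : groupType) (p0 : ORel G) : Type := ORel G.

HB.instance Definition _ (G : groupType) (p0 : ORel G) :=
  Topological.copy (pORel p0) (ORel G).
HB.instance Definition _ (G : groupType) (p0 : ORel G) :=
  isPointed.Build (pORel p0) p0.

Notation borel_ORel p0 := (g_sigma_algebraType (@open (pORel p0))).

(* Main.v *)
(** Fix a crossing.  After replacing [f] and [g] by suitable powers, [h = g f]
    moves [w] to the right but moves every [g^n w] with [n >= 1] to the left.
    Writing [w = cC], [g' = c^-1 g c] and [h' = c^-1 h c], this says that [phi]
    is positive at [h'] but at none of the [g'^-n h' g'^n]: conjugation by
    [g'^-1] never brings the order back to the open set of the orders positive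
    at [h'].  By Poincaré recurrence such orders form a null set, and there are
    only countably many pairs [(g', h')]. *)

Require Import Defs.
From HB Require Import structures.
From mathcomp Require Import all_boot all_order all_algebra.
From mathcomp Require Import all_classical all_reals all_analysis.

Local Open Scope classical_set_scope.

Import Order.TTheory GRing.Theory Num.Theory.

Section Dynamics.
Local Open Scope group_scope.
Context {G : groupType} {d : Order.disp_t} {Omega : orderType d}.
Variable a : order_action G Omega.

Lemma oactK f : cancel (a f) (a f^-1).
Proof. by move=> x; rewrite -oactM mulVg oact1. Qed.

Lemma oact_lt f : {mono a f : x y / (x < y)%O}.
Proof.
apply: leW_mono => x y; apply/idP/idP; last exact: oact_homo.
by move=> /(oact_homo a f^-1); rewrite !oactK.
Qed.

(** With [k = g ^+ M], [f ^+ N] keeps [w] above [u], so [k] then lifts it past [w]. Each [k ^+ n.+1]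
    keeps [w] below [v], so [f ^+ N] drops that point below [w], and [k] returns it only below
    [k w]. *)
Lemma crossing_wandering f g u v w : crossing a f g u v w ->
  exists k h, (w < a h w)%O /\
    forall n, (a h (a (k ^+ n.+1) w) < a (k ^+ n.+1) w)%O.
Proof.
move=> [/andP[uw wv] uv [M [N /andP[fw gw]]]].
exists (g ^+ M), (g ^+ M * f ^+ N).
(* Doubling the exponent: [u < f^(2N) v = f^N (f^N v) < f^N w]. *)
have uf : (u < a (f ^+ N) w)%O.
  have [_] := uv (N + N)%N; rewrite expgnDr oactM => /lt_trans; apply.
  by rewrite oact_lt.
have incr n : (w < a (g ^+ M ^+ n.+1) u)%O.
  elim: n => [|n IH]; first by rewrite expg1.
  by rewrite expgS oactM (lt_trans gw)// oact_lt (lt_trans uw).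
split=> [|n]; rewrite oactM; first by rewrite (lt_trans gw)// oact_lt.
(* One more power of [k = g ^+ M] passes from [w] to [u]: since [w < k u], [k^(n+1) w] is below
   [k^(n+2) u < v]. *)
have gv : (a (g ^+ M ^+ n.+1) w < v)%O.
  have [+ _] := uv (M * n.+2)%N; apply: le_lt_trans.
  by rewrite mulnSr expgnDr oactM expgnA oact_homo// ltW.
have ggw : (a (g ^+ M) w <= a (g ^+ M ^+ n.+1) w)%O.
  rewrite expgS oactM oact_homo//; case: n {gv} => [|n].
    by rewrite expg0 oact1.
  by rewrite (le_trans (ltW (incr n)))// oact_homo// ltW.
by rewrite (lt_le_trans _ ggw)// oact_lt (lt_trans _ fw)// oact_lt.
Qed.

End Dynamics.

(** Any [n] of the disjoint sets fit in a space of finite mass, so [n * c <= mu setT] for every [n],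
    and the Archimedean property applies. *)
Lemma wandering_measure0 {d} {T : measurableType d} {R : realType}
    (mu : {finite_measure set T -> \bar R}%R) (F : (set T)^nat) (c : \bar R) :
  (forall n, measurable (F n)) -> trivIset setT F -> (forall n, mu (F n) = c) ->
  c = 0%E.
Proof.
move=> mF tF Fc.
have c0 : (0 <= c)%E by rewrite -(Fc 0%N).
have cfin : c \is a fin_num by rewrite -(Fc 0%N) fin_num_measure.
have Tfin : mu setT \is a fin_num by rewrite fin_num_measure.
have le n : (fine c *+ n <= fine (mu setT))%R.
  have -> : (fine c *+ n)%R = fine (mu (\big[setU/set0]_(i < n) F i)).
    rewrite measure_bigsetU// (eq_bigr (fun=> (fine c)%:E)).
      by rewrite sumEFin sumr_const card_ord.
    by move=> i _; rewrite fineK//; exact: Fc.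
  apply: fine_le => //; first by rewrite fin_num_measure//; exact: bigsetU_measurable.
  by apply: le_measure => //; rewrite inE//; exact: bigsetU_measurable.
apply/eqP; rewrite -(fineK cfin) eqe; apply/negP => /negP cn0.
have cp : (0 < fine c)%R by rewrite lt_neqAle eq_sym cn0 fine_ge0.
have := le (Num.bound (fine (mu setT) / fine c)); rewrite leNgt.
rewrite -mulr_natl -ltr_pdivrMr//.
by rewrite archi_boundP// divr_ge0// fine_ge0.
Qed.

Section Countability.
Local Open Scope group_scope.

Lemma finitely_generated_countable (G : groupType) :
  finitely_generated G -> exists e : nat -> G, forall g, exists n, e n = g.
Proof.
move=> [s sG].
(* [false] marks an inverse; indices beyond [s] read the default [1], so every list of pairs spells
   a word. *)
pose letter (x : bool * nat) : G := if x.1 then nth 1 s x.2 else (nth 1 s x.2)^-1.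
pose word (l : seq (bool * nat)) : G := \prod_(x <- l) letter x.
exists (fun n => word (odflt [::] (unpickle n))) => g.
have wordV l : exists l', word l' = (word l)^-1.
  elim: l => [|[b i] l [l' l'E]].
    by exists [::]; rewrite /word big_nil invg1.
  exists (l' ++ [:: (~~ b, i)]); rewrite /word big_cat big_seq1 big_cons /=.
  by rewrite invgM -l'E /letter /=; case: b; rewrite ?invgK.
suff : range word g by move=> [l _ <-]; exists (pickle l); rewrite pickleK.
have : smallest (@is_subgroup G) [set` s] g by rewrite sG.
apply; split.
  split; first by apply/mem_set; exists [::]; rewrite // /word big_nil.
  move=> x y /set_mem[l _ <-] /set_mem[l' _ <-]; have [l'' E] := wordV l'.
  by apply/mem_set; exists (l ++ l''); rewrite // /word big_cat /= -E.
move=> x /= xs; exists [:: (true, index x s)] => //.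
by rewrite /word big_seq1 /letter/= nth_index.
Qed.

End Countability.

Section WanderingOrders.
Local Open Scope group_scope.
Context {G : groupType} (p0 : ORel G).

Definition pos_at (h : G) : set (borel_ORel p0) := [set p | val p h = Pos].

Lemma pos_at_measurable h : measurable (pos_at h).
Proof.
apply: sub_sigma_algebra.
exists (proj h @^-1` [set Pos]) => //.
by apply: open_comp => [p _|]; [exact: proj_continuous | exact: discrete_open].
Qed.

(* The orders in [pos_at h] that conjugation by [k^-1] never brings back. *)
Definition wandering (k h : G) : set (borel_ORel p0) :=
  pos_at h `\` \bigcup_n pos_at (k ^- n.+1 * h * k ^+ n.+1).

Lemma wandering_measurable k h : measurable (wandering k h).
Proof.
apply: measurableD; first exact: pos_at_measurable.
by apply: bigcupT_measurable => n; exact: pos_at_measurable.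
Qed.

Lemma pos_at_conj g h : conj_ORel g @^-1` pos_at h = pos_at (g * h * g^-1).
Proof. by []. Qed.

Lemma wandering_conj k h n : conj_ORel (k ^- n) @^-1` wandering k h =
  pos_at (k ^- n * h * k ^+ n) `\`
  \bigcup_m pos_at (k ^- (n + m.+1) * h * k ^+ (n + m.+1)).
Proof.
rewrite /wandering !setDE preimage_setI -preimage_setC preimage_bigcup.
rewrite pos_at_conj invgK; congr (_ `&` ~` _).
apply: eq_bigcupr => m _; rewrite pos_at_conj invgK.
by rewrite (addnC n) !expgnDr invgM !mulgA.
Qed.

(** An order in the [n]-th set is positive at the [n]-th conjugate of [h] and at no later one, which
    determines [n]. *)
Lemma wandering_trivIset k h :
  trivIset setT (fun n => conj_ORel (k ^- n) @^-1` wandering k h).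
Proof.
have disj i j p : (i < j)%N -> (conj_ORel (k ^- i) @^-1` wandering k h) p ->
    ~ (conj_ORel (k ^- j) @^-1` wandering k h) p.
  rewrite !wandering_conj => ij [_ nj] [pj _]; apply: nj.
  by exists (j - i).-1 => //; rewrite prednK ?subn_gt0// subnKC// ltnW.
move=> i j _ _ [p [pi pj]]; case: (ltngtP i j) => // ij; exfalso.
  exact: disj ij pi pj.
exact: disj ij pj pi.
Qed.

(** By invariance, the disjoint preimages under the powers of [k^-1] all have the measure of the set
    itself. *)
Lemma wandering_null {R : realType} (mu : probability (borel_ORel p0) R) k h :
  (forall (g : G) (A : set (borel_ORel p0)), measurable A ->
     mu (conj_ORel g @^-1` A) = mu A) ->
  mu (wandering k h) = 0%E.
Proof.
move=> inv; have mW := wandering_measurable k h.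
apply: (@wandering_measure0 _ _ _ mu _ _ _ (wandering_trivIset k h)) => n.
  rewrite wandering_conj; apply: measurableD; first exact: pos_at_measurable.
  by apply: bigcupT_measurable => m; exact: pos_at_measurable.
exact: inv.
Qed.

End WanderingOrders.

Section CrossingsOfOrders.
Local Open Scope group_scope.
Context {G : groupType} (r : rel_order G).

(** Evaluation on representatives, used to pass between [coset_at] and the action. *)
Lemma lmul_action_coset_at h c :
  lmul_action r h (coset_at r c) = coset_at r (h * c).
Proof. exact: lmul_coset_class. Qed.

(** [phi] only sees comparisons with the base coset; translating by [c^-1] brings the coset of [c]
    there. *)
Lemma phi_Pos h c : phi r (c^-1 * h * c) = Pos <->
  (coset_at r c < lmul_action r h (coset_at r c))%O.
Proof.
rewrite -(oact_lt (lmul_action r) c^-1) !lmul_action_coset_at mulVg mulgA /phi.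
by case: ifP => // _; case: ifP.
Qed.

Lemma crossing_ORel_of (p0 : ORel G) f g u v w :
  crossing (lmul_action r) f g u v w ->
  exists k h, wandering p0 k h (ORel_of r).
Proof.
move=> /crossing_wandering[k [h [wh hk]]].
have [c wE] := coset_classP w; have {}wE : w = coset_at r c by [].
exists (c^-1 * k * c), (c^-1 * h * c); split; first by apply/phi_Pos; rewrite -wE.
have kX i : (c^-1 * k * c) ^+ i = c^-1 * k ^+ i * c.
  elim: i => [|i IH]; first by rewrite !expg0 mulg1 mulVg.
  by rewrite !expgS IH !mulgA mulgK.
move=> [i _]; have := hk i; rewrite wE lmul_action_coset_at => /lt_geF hki.
rewrite /pos_at /= kX.
(* In this form [phi_Pos] speaks of [h] at the coset [k ^+ i.+1 w]. *)
have -> : (c^-1 * k ^+ i.+1 * c)^-1 * (c^-1 * h * c) * (c^-1 * k ^+ i.+1 * c) =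
   (k ^+ i.+1 * c)^-1 * h * (k ^+ i.+1 * c).
  by rewrite !invgM invgK !mulgA !mulgK.
by move=> /phi_Pos/ltW; rewrite hki.
Qed.

End CrossingsOfOrders.

Theorem mainTheorem5 (R : realType) (G : groupType) (p0 : ORel G)
    (mu : probability (borel_ORel p0) R) :
  finitely_generated G ->
  (forall (g : G) (A : set (borel_ORel p0)), measurable A ->
     mu (conj_ORel g @^-1` A) = mu A) ->
  exists Z : set (borel_ORel p0),
    [/\ measurable Z, mu Z = 0%E &
        forall r : rel_order G, ~ Z (ORel_of r) -> no_crossings (lmul_action r)].
Proof.
move=> /finitely_generated_countable[e e_surj] inv.
(* As [e] is onto, this countable union covers all pairs in [G], whichever order and crossing they
   come from. *)
exists (\bigcup_m \bigcup_n wandering p0 (e m) (e n)).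
have mW m : measurable (\bigcup_n wandering p0 (e m) (e n)).
  by apply: bigcupT_measurable => n; exact: wandering_measurable.
split; first exact: bigcupT_measurable.
  apply/negligibleP; first exact: bigcupT_measurable.
  apply: negligible_bigcup => m; apply: negligible_bigcup => n.
  by apply/negligibleP; [exact: wandering_measurable | exact: wandering_null].
move=> r nZ f g u v w /(crossing_ORel_of r p0)[k [h khr]]; apply: nZ.
have [m mE] := e_surj k; have [n nE] := e_surj h.
by exists m => //; exists n => //; rewrite mE nE.
Qed.
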